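(* For every ordinal $\alpha\ge\omega$, the class $CRSA_\alpha$ of completely representable algebras in $SA_\alpha$ is elementary; moreover it is axiomatized by a finite schema.
   Context: For distinct $i,j\in\alpha$, $[i,j]$ is the transposition of $\alpha$ swapping $i$ and $j$, and $[i|j]$ is the map $\alpha\to\alpha$ sending $i$ to $j$ and fixing everything else. For a set $U$, a set $V\subseteq{}^\alpha U$ is locally square if $s\circ[i|j],\,s\circ[i,j]\in V$ for all $s\in V$ and $i\neq j\in\alpha$; then $\wp(V)=\langle\mathcal P(V);\cap,\sim,S^i_j,S_{ij}\rangle_{i\ne j\in\alpha}$ with $\sim$ complement in $V$, $S^i_j(X)=\{q\in V:q\circ[i|j]\in X\}$ and $S_{ij}(X)=\{q\in V:q\circ[i,j]\in X\}$. For finite $n\geq 2$, $\Sigma_n$ is the following finite set of equations in the type $\{\cdot,-,s^i_j,s_{ij}\}_{i\ne j\in n}$: (a) the Boolean algebra axioms; (b) each $s_{ij}$ and each $s^i_j$ is a Boolean endomorphism; (c) for a fixed finite presentation of the monoid ${}^nn$ (all maps $n\to n$ under composition) in the generators $[i,j],[i|j]$, all equations $s_{g_1}\cdots s_{g_m}x=s_{h_1}\cdots s_{h_k}x$ for the defining relations $g_1\circ\cdots\circ g_m=h_1\circ\cdots\circ h_k$, where $s_{[i,j]}=s_{ij}$, $s_{[i|j]}=s^i_j$. $\Sigma_\alpha$ is the set of all equations in the type $\{\cdot,-,s^i_j,s_{ij}\}_{i\neq j\in\alpha}$ obtained from equations in $\Sigma_n$, $2\le n<\omega$, by replacing the indices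 along an injection $\rho:n\to\alpha$. $SA_\alpha=\mathbf{Mod}(\Sigma_\alpha)$. A representation of $\mathfrak A$ is an injective homomorphism $f:\mathfrak A\to\wp(V)$ with $V$ locally square; it is complete if $f(\prod X)=\bigcap_{x\in X}f(x)$ for every $X\subseteq\mathfrak A$ whose meet $\prod X$ exists in $\mathfrak A$. $\mathfrak A$ is completely representable if it has a complete representation. A class of algebras of dimension $\alpha$ is axiomatized by a finite schema if it is the class of models of $\{\rho(e):\rho:\omega\to\alpha\text{ an injection},\ e\in\Gamma\}$ for some finite set $\Gamma$ of first order sentences in the language of dimension $\omega$ (symbols $\cdot,-,s^i_j,s_{ij}$, $i\ne j\in\omega$), where $\rho(e)$ is obtained from $e$ by replacing each $s^i_j$ by $s^{\rho(i)}_{\rho(j)}$ and each $s_{ij}$ by $s_{\rho(i)\rho(j)}$. *)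

(* Defs.v *)
From Stdlib Require List.
From mathcomp Require Import all_boot.
From mathcomp Require Import boolp classical_sets cardinality.

Set Implicit Arguments.
Unset Strict Implicit.
Unset Printing Implicit Defensive.

Local Open Scope classical_set_scope.

(* [gen I] is at once the set of generator symbols [i,j], [i|j] of a
   transformation monoid and the set of operation symbols s_ij, s^i_j of the
   type of dimension I, so that s_g is the operation symbol attached to g. *)
Inductive gen (I : eqType) : Type :=
| Transp (i j : I) of i != j
| Repl (i j : I) of i != j.

Definition gen_fun (I : eqType) (g : gen I) : I -> I :=
  match g with
  | Transp i j _ => fun k => if k == i then j else if k == j then i else k
  | Repl i j _ => fun k => if k == i then j else k
  end.

Lemma neq_map (I J : eqType) (rho : I -> J) (inj_rho : injective rho)
  (i j : I) : i != j -> rho i != rho j.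
Proof. by rewrite (inj_eq inj_rho). Qed.

Definition map_gen (I J : eqType) (rho : I -> J) (inj_rho : injective rho)
    (g : gen I) : gen J :=
  match g with
  | Transp i j ij => Transp (neq_map inj_rho ij)
  | Repl i j ij => Repl (neq_map inj_rho ij)
  end.

Definition word (I : eqType) := seq (gen I).

(* g_1 g_2 ... g_m denotes g_1 \o g_2 \o ... \o g_m (rightmost map first). *)
Definition word_fun (I : eqType) (w : word I) : I -> I :=
  foldr (fun g f => gen_fun g \o f) id w.

Inductive word_cong (I : eqType) (R : seq (word I * word I)) :
  word I -> word I -> Prop :=
| WCrel (u v : word I) (r : word I * word I) :
    List.In r R -> word_cong R (u ++ r.1 ++ v) (u ++ r.2 ++ v)
| WCrefl (w : word I) : word_cong R w w
| WCsym (w1 w2 : word I) : word_cong R w1 w2 -> word_cong R w2 w1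
| WCtrans (w1 w2 w3 : word I) :
    word_cong R w1 w2 -> word_cong R w2 w3 -> word_cong R w1 w3.

Definition presents (n : nat) (R : seq (word 'I_n * word 'I_n)) : Prop :=
  (forall f : 'I_n -> 'I_n, exists w : word 'I_n, word_fun w =1 f) /\
  (forall w1 w2 : word 'I_n,
     word_cong R w1 w2 <-> word_fun w1 =1 word_fun w2).

Record algebra (I : eqType) : Type := Algebra {
  carrier :> Type;
  carrier_inhabited : inhabited carrier;
  ameet : carrier -> carrier -> carrier;
  acompl : carrier -> carrier;
  aop : gen I -> carrier -> carrier
}.

Inductive term (I : eqType) : Type :=
| Var of nat
| Meet of term I & term I
| Compl of term I
| Op of gen I & term I.

Arguments Var {I}.

Inductive formula (I : eqType) : Type :=
| Eq of term I & term I
| Bot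
| Imp of formula I & formula I
| All of nat & formula I.

Section Semantics.
Variables (I : eqType) (A : algebra I).

Fixpoint eval (v : nat -> A) (t : term I) : A :=
  match t with
  | Var n => v n
  | Meet t1 t2 => ameet (eval v t1) (eval v t2)
  | Compl t1 => acompl (eval v t1)
  | Op g t1 => aop g (eval v t1)
  end.

Definition update (v : nat -> A) (n : nat) (a : A) : nat -> A :=
  fun m => if m == n then a else v m.

Fixpoint sat (v : nat -> A) (phi : formula I) : Prop :=
  match phi with
  | Eq t1 t2 => eval v t1 = eval v t2
  | Bot => False
  | Imp p q => sat v p -> sat v q
  | All n p => forall a : A, sat (update v n a) p
  end.

Definition models (phi : formula I) : Prop := forall v : nat -> A, sat v phi.

End Semantics.

Fixpoint term_vars (I : eqType) (t : term I) : seq nat :=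
  match t with
  | Var n => [:: n]
  | Meet t1 t2 => term_vars t1 ++ term_vars t2
  | Compl t1 => term_vars t1
  | Op _ t1 => term_vars t1
  end.

Fixpoint free_vars (I : eqType) (phi : formula I) : seq nat :=
  match phi with
  | Eq t1 t2 => term_vars t1 ++ term_vars t2
  | Bot => [::]
  | Imp p q => free_vars p ++ free_vars q
  | All n p => [seq m <- free_vars p | m != n]
  end.

Definition sentence (I : eqType) (phi : formula I) : Prop :=
  free_vars phi = [::].

Section Reindexing.
Variables (I J : eqType) (rho : I -> J) (inj_rho : injective rho).

Fixpoint map_term (t : term I) : term J :=
  match t with
  | Var n => Var n
  | Meet t1 t2 => Meet (map_term t1) (map_term t2)
  | Compl t1 => Compl (map_term t1)
  | Op g t1 => Op (map_gen inj_rho g) (map_term t1)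
  end.

Fixpoint map_formula (phi : formula I) : formula J :=
  match phi with
  | Eq t1 t2 => Eq (map_term t1) (map_term t2)
  | Bot => Bot J
  | Imp p q => Imp (map_formula p) (map_formula q)
  | All n p => All n (map_formula p)
  end.

End Reindexing.

Definition equation (I : eqType) : Type := (term I * term I)%type.

Definition holds (I : eqType) (A : algebra I) (e : equation I) : Prop :=
  forall v : nat -> A, eval v e.1 = eval v e.2.

Section Equations.
Variable I : eqType.

Let x : term I := Var 0.
Let y : term I := Var 1.
Let z : term I := Var 2.
Let join (t u : term I) : term I := Compl (Meet (Compl t) (Compl u)).

(* Complemented distributive lattices, with join given by De Morgan; 0 and 1
   are not in the type and are written y.-y and y+-y. *)
Definition BA_axioms : seq (equation I) :=
  [:: (Meet x y, Meet y x);
      (join x y, join y x);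
      (Meet x (Meet y z), Meet (Meet x y) z);
      (join x (join y z), join (join x y) z);
      (Meet x (join x y), x);
      (join x (Meet x y), x);
      (Meet x (join y z), join (Meet x y) (Meet x z));
      (join x (Meet y z), Meet (join x y) (join x z));
      (Meet x (Compl x), Meet y (Compl y));
      (join x (Compl x), join y (Compl y));
      (join x (Meet y (Compl y)), x);
      (Meet x (join y (Compl y)), x)].

Definition word_term (w : word I) : term I := foldr (@Op I) x w.

Inductive Sigma_fin (R : seq (word I * word I)) : equation I -> Prop :=
| Sigma_BA (e : equation I) : List.In e BA_axioms -> Sigma_fin R e
| Sigma_meet (g : gen I) :
    Sigma_fin R (Op g (Meet x y), Meet (Op g x) (Op g y))
| Sigma_compl (g : gen I) : Sigma_fin R (Op g (Compl x), Compl (Op g x))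
| Sigma_rel (r : word I * word I) :
    List.In r R -> Sigma_fin R (word_term r.1, word_term r.2).

End Equations.

(* [pres n] is the chosen finite presentation of the monoid of all maps
   n -> n, for n >= 2. *)
Definition Sigma (pres : forall n : nat, seq (word 'I_n * word 'I_n))
    (alpha : eqType) (e : equation alpha) : Prop :=
  exists n : nat, 2 <= n /\
  exists (rho : 'I_n -> alpha) (inj_rho : injective rho) (e0 : equation 'I_n),
    Sigma_fin (pres n) e0 /\
    e = (map_term inj_rho e0.1, map_term inj_rho e0.2).

Definition SA (pres : forall n : nat, seq (word 'I_n * word 'I_n))
    (alpha : eqType) (A : algebra alpha) : Prop :=
  forall e : equation alpha, Sigma pres e -> holds A e.

Definition locally_square (alpha : eqType) (U : Type) (V : set (alpha -> U)) :
    Prop :=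
  forall (s : alpha -> U) (g : gen alpha), V s -> V (s \o gen_fun g).

Section SetAlgebra.
Variables (alpha : eqType) (U : Type) (V : set (alpha -> U)).

Definition wp_carrier : Type := {X : set (alpha -> U) | X `<=` V}.

Definition to_wp (X : set (alpha -> U)) (XV : X `<=` V) : wp_carrier :=
  exist _ X XV.

Definition wp_meet (X Y : wp_carrier) : wp_carrier :=
  to_wp (subset_trans (@subIsetl _ (sval X) (sval Y)) (svalP X)).

Definition wp_compl (X : wp_carrier) : wp_carrier :=
  to_wp (@subDsetl _ V (sval X)).

Definition wp_op (g : gen alpha) (X : wp_carrier) : wp_carrier :=
  to_wp (@subIsetl _ V [set q : alpha -> U | sval X (q \o gen_fun g)]).

Definition wp : algebra alpha :=
  @Algebra alpha wp_carrier (inhabits (to_wp (@sub0set _ V)))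
    wp_meet wp_compl wp_op.

End SetAlgebra.

Record homomorphism (I : eqType) (A B : algebra I) (f : A -> B) : Prop := {
  hom_meet : forall a b : A, f (ameet a b) = ameet (f a) (f b);
  hom_compl : forall a : A, f (acompl a) = acompl (f a);
  hom_op : forall (g : gen I) (a : A), f (aop g a) = aop g (f a)
}.

Definition ale (I : eqType) (A : algebra I) (a b : A) : Prop := ameet a b = a.

Definition is_meet (I : eqType) (A : algebra I) (X : set A) (m : A) : Prop :=
  (forall a : A, X a -> ale m a) /\
  (forall b : A, (forall a : A, X a -> ale b a) -> ale b m).

Definition representation (alpha : eqType) (A : algebra alpha) (U : Type)
    (V : set (alpha -> U)) (f : A -> wp V) : Prop :=
  [/\ locally_square V, homomorphism f & injective f].

(* Intersections are taken inside V, so the empty one is V. *)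
Definition complete (alpha : eqType) (A : algebra alpha) (U : Type)
    (V : set (alpha -> U)) (f : A -> wp V) : Prop :=
  forall (X : set A) (m : A), is_meet X m ->
    sval (f m) = V `&` \bigcap_(a in X) sval (f a).

Definition completely_representable (alpha : eqType) (A : algebra alpha) :
    Prop :=
  exists (U : Type) (V : set (alpha -> U)) (f : A -> wp V),
    representation f /\ complete f.

Definition CRSA (pres : forall n : nat, seq (word 'I_n * word 'I_n))
    (alpha : eqType) (A : algebra alpha) : Prop :=
  SA pres A /\ completely_representable A.

Definition elementary (alpha : eqType) (K : algebra alpha -> Prop) : Prop :=
  exists T : set (formula alpha),
    (forall phi : formula alpha, T phi -> sentence phi) /\
    (forall A : algebra alpha,
       K A <-> forall phi : formula alpha, T phi -> models A phi).

Definition finite_schema_axiomatizable (alpha : eqType)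
    (K : algebra alpha -> Prop) : Prop :=
  exists Gamma : seq (formula nat),
    (forall e : formula nat, List.In e Gamma -> sentence e) /\
    (forall A : algebra alpha,
       K A <-> forall (rho : nat -> alpha) (inj_rho : injective rho)
                      (e : formula nat),
                 List.In e Gamma -> models A (map_formula inj_rho e)).

(* Main.v *)
(* Among the algebras of [SA], the completely representable ones are those
   that are atomic and in which, for each generator g, the elements s_g(a), a
   an atom, have supremum 1.  In a complete representation the elements whose
   image contains a given point q form a principal ultrafilter; its generator
   is an atom, and applying this to q and to q \o g gives both conditions.
   Conversely, under these conditions every atom a and every word w have an
   atom b with a <= s_w b, and sending x to the set of all maps
   k |-> (a, word_fun w k) with a an atom below s_w x is a complete
   representation.

   Each of these conditions mentions only one generator.  It remains to reduce
   the unboundedly many relations of Sigma to finitely many: the relations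
   between words over at most 4 indices imply all relations between words with
   equal maps, so the presentation of the monoid of maps 4 -> 4 suffices. *)
Require Import Defs.
From mathcomp Require Import all_boot.
From mathcomp Require Import boolp classical_sets cardinality functions.

Set Implicit Arguments.
Unset Strict Implicit.
Unset Printing Implicit Defensive.

(** * Relations between words with few indices *)

Definition gen_over (I : eqType) (L : seq I) (g : gen I) : bool :=
  match g with
  | Transp i j _ => (i \in L) && (j \in L)
  | Repl i j _ => (i \in L) && (j \in L)
  end.

Definition word_over (I : eqType) (L : seq I) (w : word I) : bool :=
  all (gen_over L) w.

(* Total variants of the generators: [i|i] and [i,i] are the empty word. *)
Definition swp (I : eqType) (i j : I) : word I :=
  if decP (@idP (i != j)) is left H then [:: Transp H] else [::].

Definition rpl (I : eqType) (i j : I) : word I :=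
  if decP (@idP (i != j)) is left H then [:: Repl H] else [::].

Section Words.
Variable I : eqType.
Implicit Types (i j k x y : I) (L S X Y : seq I) (u v w : word I).

Lemma word_fun_cat u v : word_fun (u ++ v) =1 word_fun u \o word_fun v.
Proof. by elim: u => [//|g u IHu] x /=; rewrite IHu. Qed.

Lemma over_cat L u v : word_over L (u ++ v) = word_over L u && word_over L v.
Proof. exact: all_cat. Qed.

Lemma over_sub L1 L2 w : {subset L1 <= L2} -> word_over L1 w -> word_over L2 w.
Proof.
move=> sL; apply: sub_all => g; case: g => i j ij /= /andP[iL jL];
by rewrite !sL.
Qed.

Lemma swpE i j (ij : i != j) : swp i j = [:: Transp ij].
Proof.
rewrite /swp; case: decP => [ij'|]; last by rewrite ij.
by rewrite (bool_irrelevance ij' ij).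
Qed.

Lemma rplE i j (ij : i != j) : rpl i j = [:: Repl ij].
Proof.
rewrite /rpl; case: decP => [ij'|]; last by rewrite ij.
by rewrite (bool_irrelevance ij' ij).
Qed.

Lemma word_fun_swp i j :
  word_fun (swp i j) =1 fun k => if k == i then j else if k == j then i else k.
Proof.
rewrite /swp => k; case: decP => //= /negP; rewrite negbK => /eqP <-.
by case: eqP => [->|].
Qed.

Lemma word_fun_rpl i j : word_fun (rpl i j) =1 fun k => if k == i then j else k.
Proof.
rewrite /rpl => k; case: decP => //= /negP; rewrite negbK => /eqP <-.
by case: eqP => [->|].
Qed.

Lemma swpK i j : cancel (word_fun (swp i j)) (word_fun (swp i j)).
Proof.
move=> k; rewrite !word_fun_swp; have [->|ki] := eqVneq k i.
  by rewrite eqxx; case: eqP.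
by have [->|kj] := eqVneq k j; rewrite ?eqxx // (negPf ki) (negPf kj).
Qed.

Lemma over_swp L i j : i \in L -> j \in L -> word_over L (swp i j).
Proof. by rewrite /swp => iL jL; case: decP => //=; rewrite iL jL. Qed.

Lemma over_rpl L i j : i \in L -> j \in L -> word_over L (rpl i j).
Proof. by rewrite /rpl => iL jL; case: decP => //=; rewrite iL jL. Qed.

Lemma word_fun_in L w x : word_over L w -> x \in L -> word_fun w x \in L.
Proof.
move=> + xL; elim: w => [//|g w IHw] /= /andP[gL /IHw].
by case: g gL => i j ij /= /andP[iL jL]; do ?case: eqP.
Qed.

Lemma word_fun_notin L w x : word_over L w -> x \notin L -> word_fun w x = x.
Proof.
move=> + xL; elim: w => [//|g w IHw] /= /andP[gL /IHw ->].
by case: g gL => i j ij /= /andP[iL jL]; do ?case: eqP => // ?; subst;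
  rewrite ?iL ?jL in xL.
Qed.

(** For [k] outside [X] this collapses [X] to [k] one index at a time, so that its laws reduce to
    relations on few indices. *)
Definition fill k X : word I := flatten [seq rpl x k | x <- X].

Lemma fill_cons k x X : fill k (x :: X) = rpl x k ++ fill k X.
Proof. by []. Qed.

Lemma fill1 k x : fill k [:: x] = rpl x k.
Proof. exact: cats0. Qed.

Lemma fill_cat k X Y : fill k (X ++ Y) = fill k X ++ fill k Y.
Proof. by rewrite /fill map_cat flatten_cat. Qed.

Lemma over_fill L k X : k \in L -> {subset X <= L} -> word_over L (fill k X).
Proof.
move=> kL; elim: X => [//|x X IHX] sX; rewrite fill_cons over_cat.
rewrite over_rpl //=; last by rewrite sX ?mem_head.
by apply: IHX => y yX; rewrite sX // in_cons yX orbT.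
Qed.

Lemma word_fun_fill k X x :
  word_fun (fill k X) x = if x \in X then k else x.
Proof.
elim: X => [//|y X IHX]; rewrite fill_cons word_fun_cat /= IHX word_fun_rpl.
by rewrite in_cons; case: (x \in X); rewrite ?orbT ?orbF //; case: eqP.
Qed.

End Words.

Definition wact (I : eqType) (T : Type) (s : gen I -> T -> T) (w : word I)
  (x : T) : T := foldr s x w.

(** * Consequences of the relations over at most four indices *)

Section LocalRelations.
Variables (I : eqType) (T : Type) (s : gen I -> T -> T).
Implicit Types (i j k x y : I) (L S X Y : seq I) (u v w : word I).

Lemma wact_cat u v t : wact s (u ++ v) t = wact s u (wact s v t).
Proof. exact: foldr_cat. Qed.

(** Equality of maps is carried beside equality of actions because normal forms are later compared
    through their maps. *)
Definition sound w1 w2 : Prop :=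
  word_fun w1 =1 word_fun w2 /\ wact s w1 =1 wact s w2.

Infix "~=" := sound (at level 70).

Lemma sound_refl w : w ~= w. Proof. by split. Qed.

Lemma sound_sym w1 w2 : w1 ~= w2 -> w2 ~= w1.
Proof. by case=> e1 e2; split=> x; rewrite ?e1 ?e2. Qed.

Lemma sound_trans w2 w1 w3 : w1 ~= w2 -> w2 ~= w3 -> w1 ~= w3.
Proof. by case=> e1 e2 [e3 e4]; split=> x; rewrite ?e1 ?e2. Qed.

Lemma sound_cat u1 u2 v1 v2 : u1 ~= u2 -> v1 ~= v2 -> u1 ++ v1 ~= u2 ++ v2.
Proof.
case=> e1 e2 [e3 e4].
by split=> x; rewrite ?wact_cat ?word_fun_cat /= ?e4 ?e2 // e3 e1.
Qed.

Lemma sound_catl u v1 v2 : v1 ~= v2 -> u ++ v1 ~= u ++ v2.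
Proof. exact/sound_cat/sound_refl. Qed.

Lemma sound_catr v u1 u2 : u1 ~= u2 -> u1 ++ v ~= u2 ++ v.
Proof. by move=> e; apply: sound_cat => //; apply: sound_refl. Qed.

Hypothesis local : forall L w1 w2, size L <= 4 -> word_over L w1 -> word_over L w2 ->
  word_fun w1 =1 word_fun w2 -> wact s w1 =1 wact s w2.

Lemma sound_local L w1 w2 : size L <= 4 -> word_over L w1 -> word_over L w2 ->
  word_fun w1 =1 word_fun w2 -> w1 ~= w2.
Proof. by move=> sL o1 o2 e; split=> //; apply: (local sL). Qed.

Ltac solve_over :=
  rewrite ?over_cat; do ?[apply/andP; split]; do ?[apply: over_swp];
  do ?[apply: over_rpl]; rewrite ?inE ?eqxx ?orbT //.

Ltac solve_fun :=
  let z := fresh "z" in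
  move=> z; rewrite ?(word_fun_cat, word_fun_swp, word_fun_rpl) /=;
  rewrite ?(word_fun_cat, word_fun_swp, word_fun_rpl) /=;
  rewrite ?(word_fun_cat, word_fun_swp, word_fun_rpl) /=;
  repeat (match goal with |- context [?a == ?b] =>
    lazymatch a with context [_ == _] => fail | _ =>
    lazymatch b with context [_ == _] => fail | _ =>
    destruct (@eqP _ a b); try subst; try congruence end end end).

Ltac by_local L := apply: (@sound_local L); [by []|solve_over|solve_over|solve_fun].

(** The map [[x|k]] never takes the value [x], so a further replacement of [x] has nothing to act
    on. *)
Lemma rpl_rpl x y k : x != k -> rpl x y ++ rpl x k ~= rpl x k.
Proof. by move=> /eqP xk; by_local [:: x; y; k]. Qed.

Lemma rpl_comm x y k : x != k -> y != k ->
  rpl x k ++ rpl y k ~= rpl y k ++ rpl x k.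
Proof. by move=> /eqP xk /eqP yk; by_local [:: x; y; k]. Qed.

Lemma swp_rpl x y k : x != k -> y != k ->
  swp x y ++ rpl x k ++ rpl y k ~= rpl x k ++ rpl y k.
Proof. by move=> /eqP xk /eqP yk; by_local [:: x; y; k]. Qed.

(** [rpl x k] commutes with the factors of the fill until it meets its own copy, which absorbs
    it. *)
Lemma fill_absorb_base k x X : k \notin X -> x \in X ->
  rpl x k ++ fill k X ~= fill k X.
Proof.
elim: X => [//|z X IHX]; rewrite in_cons negb_or => /andP[kz kX].
rewrite fill_cons catA in_cons; have [->|xz /= xX] := eqVneq x z.
  by move=> _; apply/sound_catr/rpl_rpl; rewrite eq_sym.
have xk : x != k by apply: contraNneq kX => <-.
apply: sound_trans (_ : (rpl z k ++ rpl x k) ++ fill k X ~= _).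
  by apply/sound_catr/rpl_comm; rewrite // eq_sym.
by rewrite -catA; apply/sound_catl/IHX.
Qed.

(** An extra [rpl x k] is first put in front of the fill; it then swallows [rpl x y]. *)
Lemma fill_absorb k x y X : k \notin X -> x \in X ->
  rpl x y ++ fill k X ~= fill k X.
Proof.
move=> kX xX; have xk : x != k by apply: contraNneq kX => <-.
have e := fill_absorb_base kX xX.
apply: sound_trans (sound_catl _ (sound_sym e)) _.
by rewrite catA; apply: sound_trans (sound_catr _ (rpl_rpl _ xk)) e.
Qed.

Lemma fill_absorb_swp k x y X : k \notin X -> x \in X -> y \in X ->
  swp x y ++ fill k X ~= fill k X.
Proof.
move=> kX xX yX; have xk : x != k by apply: contraNneq kX => <-.
have yk : y != k by apply: contraNneq kX => <-.
have e : rpl x k ++ rpl y k ++ fill k X ~= fill k X.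
  apply: sound_trans (fill_absorb_base kX xX).
  exact/sound_catl/fill_absorb_base.
apply: sound_trans (sound_catl _ (sound_sym e)) _.
apply: sound_trans e; rewrite !catA; apply: sound_catr.
by rewrite -catA; apply: swp_rpl.
Qed.

Lemma fill_sub k X Y : k \notin Y -> {subset X <= Y} ->
  fill k X ++ fill k Y ~= fill k Y.
Proof.
move=> kY; elim: X => [|x X IHX] sX; first exact: sound_refl.
rewrite fill_cons -catA; apply: sound_trans (fill_absorb k kY _); last first.
  exact/sX/mem_head.
by apply/sound_catl/IHX => y yX; rewrite sX // in_cons yX orbT.
Qed.

Lemma fill_comm k X Y : k \notin X -> k \notin Y ->
  fill k X ++ fill k Y ~= fill k Y ++ fill k X.
Proof.
have swap1 x Z : x != k -> k \notin Z ->
    rpl x k ++ fill k Z ~= fill k Z ++ rpl x k.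
  move=> xk; elim: Z => [|z Z IHZ]; first by rewrite cats0 => _; apply: sound_refl.
  rewrite in_cons negb_or => /andP[kz kZ]; rewrite fill_cons catA.
  apply: sound_trans (sound_catr _ (rpl_comm xk _)) _; first by rewrite eq_sym.
  by rewrite -!catA; apply/sound_catl/IHZ.
move=> + kY; elim: X => [|x X IHX]; first by rewrite cats0 => _; apply: sound_refl.
rewrite in_cons negb_or => /andP[kx kX]; rewrite fill_cons -catA.
apply: sound_trans (sound_catl _ (IHX kX)) _; rewrite !catA.
by apply/sound_catr/swap1 => //; rewrite eq_sym.
Qed.

(** The two fills commute and each absorbs the other, so order and repetitions in the list do not
    matter. *)
Lemma fill_eq k X Y : k \notin X -> X =i Y -> fill k X ~= fill k Y.
Proof.
move=> kX eXY; have kY : k \notin Y by rewrite -eXY.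
apply: sound_trans (sound_sym (fill_sub kX (X := Y) _)) _.
  by move=> x; rewrite eXY.
apply: sound_trans (fill_comm kY kX) _.
by apply: fill_sub => // x; rewrite eXY.
Qed.

(** [w] moves only indices that [fill k X] has removed from the range. *)
Lemma fill_absorb_word k S X w : k \notin X -> {subset S <= X} -> word_over S w ->
  w ++ fill k X ~= fill k X.
Proof.
move=> kX sX; elim: w => [_|g w IHw /= /andP[gS wS]]; first exact: sound_refl.
rewrite -cat1s; apply: sound_trans (sound_catl _ (IHw wS)) _.
case: g gS => i j ij /andP[/sX iX /sX jX].
  by rewrite -swpE; apply: fill_absorb_swp.
by rewrite -rplE; apply: fill_absorb.
Qed.

(** [Z] is the preimage of [y] under [g]: besides [k], which [g] fixes, exactly these indices are
    sent to [k]. *)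
Lemma rpl_gen k S y g : k \notin S -> y \in S -> gen_over S g ->
  exists2 Z, {subset Z <= S} &
    rpl y k ++ [:: g] ~= [:: g] ++ fill k Z.
Proof.
move=> kS yS; case: g => a b ab /andP[aS bS].
all: have [/eqP yk /eqP ak /eqP bk] : [/\ y != k, a != k & b != k]
  by split; apply: contraNneq kS => <-.
all: have /eqP nab := ab.
  rewrite -swpE; have [eya|/eqP ya] := eqVneq y a.
    exists [:: b]; first by move=> z; rewrite inE => /eqP ->.
    by subst y; rewrite fill1; by_local [:: k; a; b].
  have [eyb|/eqP yb] := eqVneq y b.
    exists [:: a]; first by move=> z; rewrite inE => /eqP ->.
    by subst y; rewrite fill1; by_local [:: k; a; b].
  exists [:: y]; first by move=> z; rewrite inE => /eqP ->.
  by rewrite fill1; by_local [:: k; y; a; b].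
rewrite -rplE; have [eya|/eqP ya] := eqVneq y a.
  exists [::] => //.
  by subst y; by_local [:: k; a; b].
have [eyb|/eqP yb] := eqVneq y b.
  exists [:: a; b]; first by move=> z; rewrite !inE => /orP[] /eqP ->.
  by subst y; rewrite fill_cons fill1; by_local [:: k; a; b].
exists [:: y]; first by move=> z; rewrite inE => /eqP ->.
by rewrite fill1; by_local [:: k; y; a; b].
Qed.

(** The fill moves right past one generator at a time, its set turning into a preimage each time. *)
Lemma fill_word k S Y w : k \notin S -> {subset Y <= S} -> word_over S w ->
  exists2 Z, {subset Z <= S} & fill k Y ++ w ~= w ++ fill k Z.
Proof.
move=> kS; elim: w Y => [|g w IHw] Y sY /=.
  by move=> _; exists Y => //; rewrite cats0; apply: sound_refl.
case/andP=> gS wS.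
have [Z1 sZ1 e1] : exists2 Z, {subset Z <= S} &
    fill k Y ++ [:: g] ~= [:: g] ++ fill k Z.
  elim: Y sY => [|y Y IHY] sY.
    by exists [::] => //; rewrite cats0; apply: sound_refl.
  have [Z sZ eZ] : exists2 Z, {subset Z <= S} &
    fill k Y ++ [:: g] ~= [:: g] ++ fill k Z.
    by apply: IHY => z zY; rewrite sY // in_cons zY orbT.
  have [Z' sZ' eZ'] := rpl_gen kS (sY _ (mem_head _ _)) gS.
  exists (Z' ++ Z); first by move=> z; rewrite mem_cat => /orP[/sZ'|/sZ].
  rewrite fill_cons -catA; apply: sound_trans (sound_catl _ eZ) _.
  by rewrite fill_cat !catA; apply: sound_catr.
have [Z sZ eZ] := IHw _ sZ1 wS.
exists Z => //; rewrite -cat1s catA.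
apply: sound_trans (sound_catr _ e1) _.
by rewrite -!catA; apply: sound_catl.
Qed.

Ltac witness j' r Y L :=
  exists j', r, Y; split;
  [ by rewrite ?in_cons ?eqxx ?orbT //; apply/orP; right
  | by rewrite ?over_swp ?over_rpl
  | by let z := fresh in move=> z; rewrite ?inE // => /eqP ->
  | rewrite ?fill1; by_local L ].

(** Here [j'] is the image of [j] under [g], [Y] holds the indices other than [k] that the left side
    also sends to [j'], and [r] accounts for the rest. The largest cases involve [k], [j] and the
    two indices of [g]; this is the source of the bound 4. *)
Lemma gen_swp k j S g : k \notin S -> j \in k :: S -> gen_over (k :: S) g ->
  exists j' r Y, [/\ j' \in k :: S, word_over S r, {subset Y <= S} &
    [:: g] ++ swp k j ~= swp k j' ++ r ++ fill k Y].
Proof.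
Proof.
move=> kS jS gS.
have notk x : x \in S -> x <> k by move=> xS xk; rewrite -xk xS in kS.
case: g gS => a b ab /andP[]; move: jS; rewrite !in_cons.
all: have /eqP nab := ab; rewrite -?swpE -?rplE.
all: have [->|/eqP jk] := eqVneq j k => /= jS.
all: have [eak|/eqP ak] := eqVneq a k => /= aS.
all: have [ebk|/eqP bk] := eqVneq b k => /= bS; try (by case: nab; rewrite eak).
all: try subst a; try subst b.
- by witness b ([::] : word I) ([::] : seq I) [:: k; b].
- by witness a ([::] : word I) ([::] : seq I) [:: k; a].
- by witness k (swp a b) ([::] : seq I) [:: k; a; b].
- have [ebj|/eqP bj] := eqVneq b j.
    by subst b; witness k ([::] : word I) ([::] : seq I) [:: k; j].
  by witness j (swp j b) ([::] : seq I) [:: k; b; j].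
- have [eaj|/eqP aj] := eqVneq a j.
    by subst a; witness k ([::] : word I) ([::] : seq I) [:: k; j].
  by witness j (swp j a) ([::] : seq I) [:: k; a; j].
- have [eaj|/eqP aj] := eqVneq a j.
    by subst a; witness b (swp j b) ([::] : seq I) [:: k; j; b].
  have [ebj|/eqP bj] := eqVneq b j.
    by subst b; witness a (swp a j) ([::] : seq I) [:: k; j; a].
  by witness j (swp a b) ([::] : seq I) [:: k; j; a; b].
- by witness b ([::] : word I) [:: b] [:: k; b].
- by witness k ([::] : word I) [:: a] [:: k; a].
- by witness k (rpl a b) ([::] : seq I) [:: k; a; b].
- have [ebj|/eqP bj] := eqVneq b j.
    by subst b; witness j ([::] : word I) [:: j] [:: k; j].
  by witness j (rpl j b) ([::] : seq I) [:: k; b; j].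
- have [eaj|/eqP aj] := eqVneq a j.
    by subst a; witness k ([::] : word I) [:: j] [:: k; j].
  by witness j (rpl a j) ([::] : seq I) [:: k; a; j].
- have [eaj|/eqP aj] := eqVneq a j.
    by subst a; witness b (rpl j b) [:: b] [:: k; j; b].
  have [ebj|/eqP bj] := eqVneq b j.
    by subst b; witness j ([::] : word I) [:: a] [:: k; j; a].
  by witness j (rpl a b) ([::] : seq I) [:: k; j; a; b].
Qed.

(** [j] is the image of [k] and [X] the set of other indices with the same image. The rest of the
    map is carried by [h], which does not mention [k]; this opens the way to an induction on the
    index set. *)
Lemma normal_form k S w : k \notin S -> word_over (k :: S) w ->
  exists j h X, [/\ j \in k :: S, word_over S h, {subset X <= S} &
    w ~= swp k j ++ h ++ fill k X].
Proof.
move=> kS; elim: w => [_|g w IHw /= /andP[gS /IHw]].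
  exists k, [::], [::]; split; rewrite ?mem_head //.
  by by_local [:: k].
case=> j [h [X [jS hS sX e]]].
have [j' [r [Y [j'S rS sY e1]]]] := gen_swp kS jS gS.
(* The fill created by [g] has to pass [h] to join the old one. *)
have [Z sZ e2] := fill_word kS sY hS.
exists j', (r ++ h), (Z ++ X); split=> //.
- by rewrite over_cat rS.
- by move=> z; rewrite mem_cat => /orP[/sZ|/sX].
rewrite -cat1s; apply: sound_trans (sound_catl _ e) _.
rewrite catA; apply: sound_trans (sound_catr _ e1) _.
rewrite fill_cat -!catA; do 2!apply: sound_catl.
by rewrite !catA; apply: sound_catr.
Qed.

(* By induction on the index set [k :: S]: normal forms of equal maps have
   the same [j] and the same [X] up to order, and [h1], [h2] agree outside [X].
   Inserting before [fill k X] a redundant fill of [X] by some [y] outside [X]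
   makes them equal. *)
Theorem local_relations_suffice S w1 w2 : word_over S w1 -> word_over S w2 ->
  word_fun w1 =1 word_fun w2 -> w1 ~= w2.
Proof.
elim: S w1 w2 => [|k S IHS] w1 w2.
  by case: w1 => [|[] ? ? ?]; case: w2 => [|[] ? ? ?] // *; apply: sound_refl.
have [kS|kS] := boolP (k \in S).
  have sS : {subset k :: S <= S} by move=> x; rewrite in_cons => /orP[/eqP->|].
  by move=> /(over_sub sS) o1 /(over_sub sS) o2; apply: IHS.
move=> /(normal_form kS)[j1 [h1 [X1 [j1S h1S sX1 e1]]]].
move=> /(normal_form kS)[j2 [h2 [X2 [j2S h2S sX2 e2]]]] e.
have kX1 : k \notin X1 by apply: contraNN kS => /sX1.
have kX2 : k \notin X2 by apply: contraNN kS => /sX2.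
have {}e : word_fun (swp k j1 ++ h1 ++ fill k X1) =1
           word_fun (swp k j2 ++ h2 ++ fill k X2).
  by move=> x; rewrite -(proj1 e1) -(proj1 e2).
apply: sound_trans e1 (sound_trans _ (sound_sym e2)) => {e2}.
(* Both [h1], [h2] and both fills fix [k], so at [k] only the leading swap shows. *)
have ej : j1 = j2.
  move: (e k); rewrite !word_fun_cat /= !word_fun_cat /= !word_fun_fill.
  rewrite (negPf kX1) (negPf kX2) (word_fun_notin h1S kS) (word_fun_notin h2S kS).
  by rewrite !word_fun_swp eqxx.
subst j2; apply: sound_catl.
have {}e x : word_fun h1 (if x \in X1 then k else x) =
             word_fun h2 (if x \in X2 then k else x).
  move: (e x); rewrite !word_fun_cat /= !word_fun_cat /= !word_fun_fill.
  by move/(can_inj (swpK k j1)).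
(* [h1] and [h2] fix [k] and map [S] into itself, so an index of [S] reaches [k] exactly when it is
   collapsed. *)
have eX : X1 =i X2.
  move=> x; have [xS|xS] := boolP (x \in S); last first.
    by rewrite (contraNF (sX1 x) xS) (contraNF (sX2 x) xS).
  have kE := word_fun_notin h1S kS; have kE' := word_fun_notin h2S kS.
  move: (e x); case: ifP => _; case: ifP => _ //; rewrite ?kE ?kE' => ee.
    by move: kS; rewrite ee word_fun_in.
  by move: kS; rewrite -ee word_fun_in.
have eh x : x \notin X1 -> word_fun h1 x = word_fun h2 x.
  by move=> xX; move: (e x); rewrite -eX (negPf xX).
apply: sound_trans (_ : h2 ++ fill k X1 ~= _); last exact/sound_catl/fill_eq.
(* If [X1] covers [S] there is no such [y], but then [h1] and [h2] are both absorbed. *)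
have [/allP sSX|/allPn[y yS yX]] := boolP (all (mem X1) S).
  apply: sound_trans (fill_absorb_word kX1 sSX h1S) _.
  exact/sound_sym/(fill_absorb_word kX1 sSX h2S).
have abs X : {subset X <= X1} -> fill y X ++ fill k X1 ~= fill k X1.
  elim: X => [|x X IHX] sX; first exact: sound_refl.
  rewrite fill_cons -catA; apply: sound_trans (fill_absorb y kX1 _); last first.
    exact/sX/mem_head.
  by apply/sound_catl/IHX => z zX; rewrite sX // in_cons zX orbT.
have {}abs := abs X1 (fun _ => id).
apply: sound_trans (sound_catl _ (sound_sym abs)) _.
apply: sound_trans (sound_catl _ abs); rewrite !catA; apply: sound_catr.
(* Both words are now over [S], and their maps agree because [h1] and [h2] agree outside [X1], where
   [y] lies. *)
apply: IHS; rewrite ?over_cat ?h1S ?h2S ?over_fill // => x.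
rewrite !word_fun_cat /= !word_fun_fill.
by case: ifPn => xX; apply: eh.
Qed.

Corollary local_relations_wact w1 w2 :
  word_fun w1 =1 word_fun w2 -> wact s w1 =1 wact s w2.
Proof.
have [S] : exists S, word_over S (w1 ++ w2).
  elim: (w1 ++ w2) => [|g w [S oS]]; first by exists [::].
  have sub L : {subset S <= L ++ S} by move=> x; rewrite mem_cat orbC => ->.
  case: g => i j ij; exists ([:: i; j] ++ S);
  by apply/andP; split; [rewrite /= !inE !eqxx orbT | exact: over_sub (sub _) oS].
by rewrite over_cat => /andP[o1 o2] e; case: (local_relations_suffice o1 o2 e).
Qed.

End LocalRelations.

(** * Complete representability and density of atoms *)

(** The type has no constant 0, so 0 is written from a given element; by [bot_const] the choice is
    immaterial in a Boolean algebra. *)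
Definition bot (I : eqType) (A : algebra I) (a : A) : A := ameet a (acompl a).

(** The second clause is an implication so as to match [dense_formula] literally. *)
Definition atom (I : eqType) (A : algebra I) (a : A) : Prop :=
  a <> bot a /\ forall b : A, ameet a b <> a -> ameet a b = bot a.

(* For [h] a Boolean endomorphism of an atomic [A] this says that [h] is
   completely additive. For [h = id] it says that [A] is atomic. *)
Definition atoms_dense (I : eqType) (A : algebra I) (h : A -> A) : Prop :=
  forall b : A, b <> bot b ->
    exists a : A, atom a /\ ameet b (h a) <> bot (ameet b (h a)).

Definition BA (I : eqType) (A : algebra I) : Prop :=
  forall e, List.In e (BA_axioms I) -> holds A e.

(** * Boolean arithmetic and atoms *)

Section BooleanAlgebra.
Variables (I : eqType) (A : algebra I).
Hypothesis hBA : BA A.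
Implicit Types a b c x y z : A.

Let join a b := acompl (ameet (acompl a) (acompl b)).

Let env a b c (n : nat) : A := nth a [:: a; b; c] n.

(** [n] is the position of the axiom in [BA_axioms], counted from 0. *)
Ltac axiom n a b c :=
  refine (hBA (e := nth (Var 0, Var 0) (BA_axioms I) n) _ (env a b c));
  rewrite /=; tauto.

Lemma ameetC a b : ameet a b = ameet b a.
Proof. axiom 0 a b b. Qed.

Lemma ameetA a b c : ameet a (ameet b c) = ameet (ameet a b) c.
Proof. axiom 2 a b c. Qed.

Let joinC a b : join a b = join b a.
Proof. axiom 1 a b b. Qed.

Let joinKI a b : ameet a (join a b) = a.
Proof. axiom 4 a b b. Qed.

Let meetKU a b : join a (ameet a b) = a.
Proof. axiom 5 a b b. Qed.

Let meetUr a b c : ameet a (join b c) = join (ameet a b) (ameet a c).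
Proof. axiom 6 a b c. Qed.

Lemma bot_const a b : bot a = bot b.
Proof. axiom 8 a b b. Qed.

Let joinx0 a b : join a (bot b) = a.
Proof. axiom 10 a b b. Qed.

Let meetx1 a b : ameet a (join b (acompl b)) = a.
Proof. axiom 11 a b b. Qed.

Lemma ameetxx a : ameet a a = a.
Proof. by rewrite -{2}(meetKU a a) joinKI. Qed.

Lemma ale_refl a : ale a a. Proof. exact: ameetxx. Qed.

Lemma ale_trans b a c : ale a b -> ale b c -> ale a c.
Proof. by rewrite /ale => ab bc; rewrite -ab -ameetA bc. Qed.

Lemma ale_anti a b : ale a b -> ale b a -> a = b.
Proof. by rewrite /ale => ab ba; rewrite -ab ameetC ba. Qed.

Lemma ale_meet c a b : ale c (ameet a b) <-> ale c a /\ ale c b.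
Proof.
rewrite /ale; split=> [e|[ea eb]]; last by rewrite ameetA ea.
split; rewrite -e -!ameetA; congr (ameet c _).
  by rewrite (ameetC b a) ameetA ameetxx.
by rewrite ameetxx.
Qed.

Lemma ale_bot a b : ale (bot a) b.
Proof.
rewrite (bot_const a b) /ale /bot -ameetA (ameetC _ b) ameetA ameetxx.
by [].
Qed.

Lemma ale_bot_eq a b : ale a (bot b) -> a = bot a.
Proof. by move=> ab; apply: ale_anti (ale_bot _ _); rewrite (bot_const a b). Qed.

Lemma ale_contra a b : ale a b -> ale a (acompl b) -> a = bot a.
Proof. by move=> ab ab'; apply: (@ale_bot_eq _ b); apply/ale_meet. Qed.

Lemma meet_compl_ale a b : ameet a (acompl b) = bot a -> ale a b.
Proof.
move=> e; rewrite /ale -{2}(meetx1 a b) meetUr e.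
by rewrite joinx0.
Qed.

Lemma meet_ale_compl a b : ameet a b = bot a -> ale a (acompl b).
Proof.
move=> e; rewrite /ale -{2}(meetx1 a b) meetUr e joinC.
by rewrite joinx0.
Qed.

Lemma atom_compl a b : atom a -> ale a (acompl b) <-> ~ ale a b.
Proof.
move=> [a0 ha]; split=> [ab' ab|ab]; first exact/a0/(ale_contra ab ab').
exact/meet_ale_compl/ha.
Qed.

Lemma atom_ale a b : atom a -> ameet a b <> bot (ameet a b) -> ale a b.
Proof.
move=> [_ ha] ab; apply: contrapT => /ha e; apply: ab.
by rewrite e; apply: bot_const.
Qed.

(** If [x] is not below [y], some atom lies below [x] and the complement of [y]. *)
Lemma atoms_separate x y : atoms_dense (@id A) ->
  (forall a, atom a -> ale a x <-> ale a y) -> x = y.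
Proof.
have half x' y' : atoms_dense (@id A) ->
    (forall a, atom a -> ale a x' -> ale a y') -> ale x' y'.
  move=> dA h; apply: meet_compl_ale.
  rewrite (bot_const _ (ameet x' (acompl y'))); apply: contrapT => /dA.
  case=> a [ha]; rewrite ameetC => /(atom_ale ha) /ale_meet[ax ay].
  exact: (proj1 (atom_compl _ ha) ay (h _ ha ax)).
by move=> dA h; apply: ale_anti; apply: half => // a ha /h; apply.
Qed.

End BooleanAlgebra.

Lemma wp_ext (alpha : eqType) (U : Type) (V : set (alpha -> U)) (X Y : wp V) :
  (forall q, sval X q <-> sval Y q) -> X = Y.
Proof.
case: X Y => [X XV] [Y YV] /= /predeqP XY; subst Y.
by rewrite (Prop_irrelevance XV YV).
Qed.

(** * From a complete representation to density of atoms *)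

Section CompleteToAtomic.
Variables (alpha : eqType) (A : algebra alpha) (U : Type).
Variables (V : set (alpha -> U)) (f : A -> wp V).
Hypotheses (hBA : BA A) (rf : representation f) (cf : complete f).

Lemma rep_meet a b q :
  sval (f (ameet a b)) q <-> sval (f a) q /\ sval (f b) q.
Proof. by case: rf => _ [-> _ _] _. Qed.

Lemma rep_compl a q : sval (f (acompl a)) q <-> V q /\ ~ sval (f a) q.
Proof. by case: rf => _ [_ -> _] _. Qed.

Lemma rep_op g a q :
  sval (f (aop g a)) q <-> V q /\ sval (f a) (q \o gen_fun g).
Proof. by case: rf => _ [_ _ ->] _. Qed.

Lemma rep_bot a q : ~ sval (f (bot a)) q.
Proof. by move=> /rep_meet[qa /rep_compl[]]. Qed.

Lemma rep_nonempty a : a <> bot a -> exists q, sval (f a) q.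
Proof.
move=> a0; apply: contrapT => fa0; apply: a0.
have [_ _ inj] := rf; apply: inj; apply: wp_ext => q; split=> qa.
  by case: fa0; exists q.
by case: (rep_bot qa).
Qed.

(* If the ultrafilter of all [a] with [q \in f a] had no nonzero lower bound,
   its meet would be 0, and completeness would put [q] into [f 0]. *)
Lemma rep_atom q : V q ->
  exists a, [/\ atom a, sval (f a) q & forall b, sval (f b) q -> ale a b].
Proof.
move=> Vq; have [z] := carrier_inhabited A.
have [b [b0 lb]] : exists b : A,
    b <> bot b /\ forall a, sval (f a) q -> ale b a.
  apply: contrapT => nob; apply: (@rep_bot z q).
  rewrite (cf (X := [set a | sval (f a) q]%classic)).
    by split.
  split=> [a _|b lb].
    exact: ale_bot.
  rewrite (_ : b = bot b); first exact: ale_bot.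
  by apply: contrapT => b0; apply: nob; exists b.
(* Otherwise [q] lies in the image of the complement of [b], which puts [b] below its own
   complement. *)
have qb : sval (f b) q.
  apply: contrapT => qb; apply/b0/(ale_contra hBA (ale_refl hBA b))/lb.
  by apply/rep_compl; split.
exists b; split=> //; split=> // c bc.
rewrite (bot_const hBA b (ameet b c)); apply: (ale_bot_eq hBA (b := c)).
have [/lb//|qc] := pselect (sval (f c) q).
have bc' : ale b (acompl c) by apply/lb/rep_compl; split.
have := ale_refl hBA (ameet b c) => /(ale_meet hBA)[h1 h2].
by apply/ale_meet => //; split=> //; apply: ale_trans h1 bc'.
Qed.

(** For [q] in the image of [b], take the atom whose image contains [F q]; then [q] witnesses that
    [b] meets [h a]. The case [F = id] gives atomicity, and composition with a generator gives
    density for its operation. *)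
Lemma rep_dense (h : A -> A) (F : (alpha -> U) -> (alpha -> U)) :
  (forall q, V q -> V (F q)) ->
  (forall a q, V q -> sval (f a) (F q) -> sval (f (h a)) q) ->
  atoms_dense h.
Proof.
move=> VF hF b /rep_nonempty[q qb].
have Vq : V q by apply: (svalP (f b)).
have [a [ha qa _]] := rep_atom (VF _ Vq).
exists a; split=> // e; apply: (@rep_bot (ameet b (h a)) q).
by rewrite -e; apply/rep_meet; split=> //; apply: hF.
Qed.

End CompleteToAtomic.

(** * From density of atoms to a complete representation *)

Section AtomicToComplete.
Variables (alpha : eqType) (i0 : alpha) (A : algebra alpha).
Implicit Types (a b x : A) (w : word alpha).

Let act := @wact alpha A (@aop alpha A).

Hypotheses (hBA : BA A)
  (op_meet : forall g a b, aop g (ameet a b) = ameet (aop g a) (aop g b))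
  (op_compl : forall g a, aop g (acompl a) = acompl (aop g a))
  (op_word : forall w1 w2, word_fun w1 =1 word_fun w2 -> act w1 =1 act w2)
  (dense_id : atoms_dense (@id A)) (dense_op : forall g, atoms_dense (@aop _ A g)).

Lemma act_meet w a b : act w (ameet a b) = ameet (act w a) (act w b).
Proof. by elim: w => [//|g w IHw] /=; rewrite IHw op_meet. Qed.

Lemma act_compl w a : act w (acompl a) = acompl (act w a).
Proof. by elim: w => [//|g w IHw] /=; rewrite IHw op_compl. Qed.

Lemma act_mono w a b : ale a b -> ale (act w a) (act w b).
Proof. by rewrite /ale => {2}<-; rewrite act_meet. Qed.

(** Density gives an atom [a'] such that [a] meets, hence lies below, [aop g a']; the rest of the
    word is then treated with [a'] in place of [a]. *)
Lemma atom_below_act w a : atom a -> exists2 b, atom b & ale a (act w b).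
Proof.
elim: w a => [|g w IHw] a ha; first by exists a; rewrite // /ale ameetxx.
have [a' [ha' /(atom_ale hBA ha) aa']] := dense_op g (proj1 ha).
have [b hb ba'] := IHw a' ha'; exists b => //.
apply: ale_trans aa' _ => //.
by rewrite /ale -[RHS]/(aop g a') -{2}ba' op_meet.
Qed.

(** The second coordinate records the map of [w]; the constant first one lets the atom be read off
    at [i0]. *)
Definition point a w : alpha -> A * alpha := fun k => (a, word_fun w k).

Definition points : set (alpha -> A * alpha) :=
  [set q | exists a w, atom a /\ q = point a w]%classic.

Definition points_of x : set (alpha -> A * alpha) :=
  [set q | exists a w, [/\ atom a, q = point a w & ale a (act w x)]]%classic.

Lemma points_of_sub x : (points_of x `<=` points)%classic.
Proof. by move=> q [a [w [ha -> _]]]; exists a, w. Qed.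

Definition atom_rep x : wp points := to_wp (@points_of_sub x).

(** A point determines its atom and the map of its word, and by [op_word] that map determines
    [act w x]; so membership does not depend on the chosen word. *)
Lemma points_ofE a w x :
  atom a -> points_of x (point a w) <-> ale a (act w x).
Proof.
move=> ha; split=> [[b [u [_ e bx]]]|]; last by exists a, w.
have [<- _] : (b, word_fun u i0) = (a, word_fun w i0) by rewrite -[LHS]/(point b u i0) -e.
rewrite (op_word (w2 := u)) // => k.
by move: (congr1 (fun q => (q k).2) e).
Qed.

Lemma point_gen a w g : point a w \o gen_fun g = point a (w ++ [:: g]).
Proof. by apply/funext => k; rewrite /point /= word_fun_cat. Qed.

Lemma points_square : locally_square points.
Proof. by move=> _ g [a [w [ha ->]]]; exists a, (w ++ [:: g]); rewrite point_gen. Qed.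

Lemma atom_rep_hom : homomorphism atom_rep.
Proof.
split=> [a b|a|g a]; apply: wp_ext => q; split.
- case=> c [w [hc -> cab]]; move: cab; rewrite act_meet => /(ale_meet hBA)[ca cb].
  by split; apply/points_ofE.
- case=> -[c [w [hc -> ca]]] /(points_ofE _ _ hc) cb.
  by apply/points_ofE; rewrite // act_meet; apply/ale_meet.
- case=> c [w [hc -> cab]]; split; first by exists c, w.
  move/(points_ofE _ _ hc); apply/(atom_compl hBA _ hc).
  by rewrite -act_compl.
- case=> -[c [w [hc ->]]] nca; apply/points_ofE => //; rewrite act_compl.
  by apply/(atom_compl hBA _ hc) => ca; apply/nca/points_ofE.
- case=> c [w [hc -> ca]]; split; first by exists c, w.
  by rewrite /= point_gen; apply/points_ofE; rewrite // /act wact_cat.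
- case=> -[c [w [hc ->]]] /=; rewrite point_gen => /(points_ofE _ _ hc) ca.
  by apply/points_ofE => //; move: ca; rewrite /act wact_cat.
Qed.

(** At points of the empty word membership is [ale a x], and atoms separate elements. *)
Lemma atom_rep_inj : injective atom_rep.
Proof.
move=> x y e; apply: atoms_separate => // a ha.
rewrite -[x]/(act [::] x) -[y]/(act [::] y) -!points_ofE //.
by rewrite -[points_of x]/(sval (atom_rep x)) e.
Qed.

Lemma atom_rep_complete : complete atom_rep.
Proof.
move=> X m [lb glb]; apply/predeqP => q; split.
  case=> a [w [ha -> am]]; split; first by exists a, w.
  move=> x Xx; apply/points_ofE => //; apply: ale_trans am _ => //.
  exact/act_mono/lb.
case=> -[a [w [ha ->]]] h; apply/points_ofE => //.
(* This [b] is below every [x] in [X]: otherwise it is below the complement of [x], which forces [a]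
   below the complement of [act w x]. *)
have [b hb ab] := atom_below_act w ha.
apply: (ale_trans hBA ab); apply/act_mono/glb => x Xx.
apply: contrapT => /(atom_compl hBA _ hb) /(act_mono w); rewrite act_compl => bx.
have /(atom_compl hBA _ ha) := ale_trans hBA ab bx; apply.
by apply/points_ofE => //; apply: h.
Qed.

Theorem atomic_completely_representable : completely_representable A.
Proof.
exists (A * alpha)%type, points, atom_rep; split; last exact: atom_rep_complete.
split; [exact: points_square|exact: atom_rep_hom|exact: atom_rep_inj].
Qed.

End AtomicToComplete.

(** * The schema *)

(** The list is enumerated first, followed by a sequence of distinct elements of its infinite
    complement. *)
Lemma extend_injection (alpha : eqType) (L : seq alpha) :
  infinite_set (@setT alpha) -> uniq L ->
  exists2 rho : nat -> alpha, injective rho &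
    forall x i, i < size L -> rho i = nth x L i.
Proof.
move=> inf uL; have : infinite_set (setT `\` [set x | x \in L])%classic.
  by apply: infinite_setD => //; apply: finite_seq.
move=> /infiniteP/card_leP/unsquash e0.
pose toT n : [set: nat]%classic := SigSub (mem_set (I : [set: nat]%classic n)).
pose e n := val (e0 (toT n)).
have eL n : e n \notin L by have /set_mem[_ /= /negP] := valP (e0 (toT n)).
have einj : injective e.
  move=> m n /val_inj emn; suff /(congr1 val) : toT m = toT n by [].
  by apply: (@inj _ _ _ e0) emn; rewrite inE.
pose x0 := e 0.
exists (fun n => if n < size L then nth x0 L n else e (n - size L)).
  move=> m n; case: ltnP => [mL|Lm]; case: ltnP => [nL|Ln].
  - by move/eqP; rewrite nth_uniq // => /eqP.
  - by move=> h; have := eL (n - size L); rewrite -h mem_nth.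
  - by move=> h; have := eL (m - size L); rewrite h mem_nth.
  - by move/einj => h; rewrite -(subnK Lm) h subnK.
by move=> x i iL; rewrite iL; apply: set_nth_default.
Qed.

(** * Reindexing along injections *)

Section Reindex.
Variables (I J : eqType) (rho : I -> J) (inj_rho : injective rho).

Definition map_word : word I -> word J := map (map_gen inj_rho).

Definition map_equation (e : equation I) : equation J :=
  (map_term inj_rho e.1, map_term inj_rho e.2).

Lemma map_word_term w : map_term inj_rho (word_term w) = word_term (map_word w).
Proof. by elim: w => [//|g w /= ->]. Qed.

Lemma word_fun_map w i : word_fun (map_word w) (rho i) = rho (word_fun w i).
Proof.
elim: w => [//|g w /= ->]; case: g => a b ab /=; rewrite !(inj_eq inj_rho);
by do ?case: eqP.
Qed.

Lemma word_fun_map_out w k :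
  (forall i, k <> rho i) -> word_fun (map_word w) k = k.
Proof.
move=> out; elim: w => [//|g w /= ->]; case: g => a b ab /=;
by do ?[case: eqP => [/out//|_]].
Qed.

Lemma word_fun_map_eq u v :
  word_fun u =1 word_fun v -> word_fun (map_word u) =1 word_fun (map_word v).
Proof.
move=> e k; have [[i ->]|out] := pselect (exists i, k = rho i).
  by rewrite !word_fun_map e.
by rewrite !word_fun_map_out // => i ki; apply: out; exists i.
Qed.

Lemma lift_word L w : word_over L w -> (forall x, x \in L -> exists i, x = rho i) ->
  exists u, w = map_word u.
Proof.
move=> + im; elim: w => [|g w IHw /= /andP[gL /IHw[u ->]]]; first by exists [::].
suff [g' ->] : exists g', g = map_gen inj_rho g' by exists (g' :: u).
case: g gL => a b ab /= /andP[/im[i ai] /im[j bj]]; subst a b.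
all: have ij : i != j by rewrite -(inj_eq inj_rho).
  by exists (Transp ij); rewrite /= (bool_irrelevance ab (neq_map inj_rho ij)).
by exists (Repl ij); rewrite /= (bool_irrelevance ab (neq_map inj_rho ij)).
Qed.

End Reindex.

Lemma map_term_comp (I J K : eqType) (f : I -> J) (g : J -> K)
    (inj_f : injective f) (inj_g : injective g) (inj_gf : injective (g \o f)) t :
  map_term inj_g (map_term inj_f t) = map_term inj_gf t.
Proof.
elim: t => [//|t1 /= -> t2 -> //|t /= -> //|h t /= ->]; congr (Op _ _).
by case: h => i j ij /=; [congr Transp|congr Repl]; apply: bool_irrelevance.
Qed.

Lemma map_equation_comp (I J K : eqType) (f : I -> J) (g : J -> K)
    (inj_f : injective f) (inj_g : injective g) (inj_gf : injective (g \o f)) e :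
  map_equation inj_g (map_equation inj_f e) = map_equation inj_gf e.
Proof. by rewrite /map_equation /= !(map_term_comp inj_f inj_g inj_gf). Qed.

Lemma eval_word_term (I : eqType) (A : algebra I) (v : nat -> A) w :
  eval v (word_term w) = wact (@aop I A) w (v 0).
Proof. by elim: w => [//|g w /= ->]. Qed.

Lemma In_cat (T : Type) (x : T) s1 s2 :
  List.In x (s1 ++ s2) <-> List.In x s1 \/ List.In x s2.
Proof. by elim: s1 => [|y s1 IHs] /=; [tauto|rewrite IHs; tauto]. Qed.

Lemma In_map (T U : Type) (f : T -> U) y s :
  List.In y (map f s) <-> exists x, f x = y /\ List.In x s.
Proof.
elim: s => [|z s IHs] /=; first by split=> // -[? []].
rewrite IHs; split=> [[<-|[x [<- xs]]]|[x [<- [->|xs]]]]; last 1 first.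
- by right; exists x.
- by exists z; split=> //; left.
- by exists x; split=> //; right.
- by left.
Qed.

(** * The sentences of the schema *)

Definition endo_axioms (I : eqType) (g : gen I) : seq (equation I) :=
  [:: (Op g (Meet (Var 0) (Var 1)), Meet (Op g (Var 0)) (Op g (Var 1)));
      (Op g (Compl (Var 0)), Compl (Op g (Var 0)))].

(** Three quantifiers suffice for a sentence, since the equations of the schema use only the
    variables 0, 1 and 2. *)
Definition closure (I : eqType) (e : equation I) : formula I :=
  All 0 (All 1 (All 2 (Eq e.1 e.2))).

Lemma models_closure (I : eqType) (A : algebra I) (e : equation I) :
  models A (closure e) <-> holds A e.
Proof.
split=> h v /=; last by move=> a b c; apply: h.
have := h v (v 0) (v 1) (v 2); rewrite /= (_ : update _ _ _ = v) //.
by apply/funext => -[|[|[|n]]].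
Qed.

Definition low_vars (I : eqType) (t : term I) : bool :=
  all (fun n => n < 3) (term_vars t).

Lemma closure_sentence (I : eqType) (e : equation I) :
  low_vars e.1 -> low_vars e.2 -> sentence (closure e).
Proof.
rewrite /sentence /low_vars /= => l1 l2.
have : all (fun n => n < 3) (term_vars e.1 ++ term_vars e.2) by rewrite all_cat l1.
elim: (_ ++ _) => [//|n s IHs] /= /andP[n3 /IHs].
by case: n n3 => [|[|[|]]].
Qed.

Lemma low_vars_map (I J : eqType) (rho : I -> J) (inj_rho : injective rho) t :
  low_vars (map_term inj_rho t) = low_vars t.
Proof.
rewrite /low_vars; elim: t => [//|t1 IH1 t2 IH2|t IH|g t IH] //=.
by rewrite !all_cat IH1 IH2.
Qed.

Lemma low_vars_word (I : eqType) (w : word I) : low_vars (word_term w).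
Proof. by elim: w. Qed.

Definition nonzero (I : eqType) (t : term I) : formula I :=
  Imp (Eq t (Meet t (Compl t))) (Bot I).

(** This expresses [atoms_dense h], where [t] is a term for [h] applied to variable 1, the atom; the
    existential is a negated universal. *)
Definition dense_formula (I : eqType) (t : term I) : formula I :=
  let x := Var 0 in let y := Var 1 in let z := Var 2 in
  All 0 (Imp (nonzero x)
    (Imp (All 1 (Imp (nonzero y)
           (Imp (All 2 (Imp (Imp (Eq (Meet y z) y) (Bot I))
                            (Eq (Meet y z) (Meet y (Compl y)))))
                (Imp (nonzero (Meet x t)) (Bot I)))))
         (Bot I))).

Lemma models_dense (I : eqType) (A : algebra I) (t : term I) (h : A -> A) :
  (forall v, eval v t = h (v 1)) ->
  models A (dense_formula t) <-> atoms_dense h.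
Proof.
move=> th; have [z0] := carrier_inhabited A; split=> [m b b0|d v /= b b0 noa].
  apply: contrapT => noa; apply: (m (fun=> z0) b b0) => a /= a0 ha; rewrite th => na.
  by apply: noa; exists a.
have [a [[a0 ha] na]] := d b b0.
by apply: (noa a a0 ha); rewrite th.
Qed.

Section Schema.
Variable pres : forall n : nat, seq (word 'I_n * word 'I_n).

Let o0 : 'I_4 := @Ordinal 4 0 isT.
Let o1 : 'I_4 := @Ordinal 4 1 isT.
Let o01 : o0 != o1 := isT.
Let n01 : 0 != 1 := isT.

(** The endomorphism axioms are listed for the pair 0, 1 alone, since injections carry it to every
    pair of distinct indices. *)
Definition equations4 : seq (equation 'I_4) :=
  BA_axioms 'I_4 ++ endo_axioms (Transp o01) ++ endo_axioms (Repl o01) ++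
  [seq (word_term r.1, word_term r.2) | r <- pres 4].

Definition schema : seq (formula nat) :=
  [seq closure (map_equation (@ord_inj 4) e) | e <- equations4] ++
  [:: dense_formula (Var 1); dense_formula (Op (Transp n01) (Var 1));
      dense_formula (Op (Repl n01) (Var 1))].

Lemma equations4_low e : List.In e equations4 -> low_vars e.1 && low_vars e.2.
Proof.
rewrite /equations4 !In_cat In_map.
case=> [|[|[|]]]; last by move=> [r [<- _]]; rewrite !low_vars_word.
all: by rewrite /=; intuition; subst.
Qed.

Lemma schema_sentence e : List.In e schema -> sentence e.
Proof.
rewrite /schema In_cat In_map => -[[e0 [<- /equations4_low]]|].
  by case/andP=> l1 l2; apply: closure_sentence; rewrite low_vars_map.
by case=> [<-|[<-|[<-|[]]]].
Qed.

Lemma equations4_Sigma e : List.In e equations4 -> Sigma_fin (pres 4) e.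
Proof.
rewrite /equations4 !In_cat In_map.
case=> [|[|[|[r [<-]]]]]; first exact: Sigma_BA.
- by case=> [<-|[<-|[]]]; [apply: Sigma_meet|apply: Sigma_compl].
- by case=> [<-|[<-|[]]]; [apply: Sigma_meet|apply: Sigma_compl].
- exact: Sigma_rel.
Qed.

(** * Models of the schema *)

Section Models.
Variables (alpha : eqType) (A : algebra alpha).
Hypothesis inf_alpha : infinite_set (@setT alpha).
Hypothesis Hpres : forall n : nat, 2 <= n -> presents (pres n).

Lemma models_schema :
  (forall (rho : nat -> alpha) (inj_rho : injective rho) e,
     List.In e schema -> models A (map_formula inj_rho e)) <->
  (forall (rho : nat -> alpha) (inj_rho : injective rho),
     let inj4 := inj_comp inj_rho (@ord_inj 4) in
     (forall e, List.In e equations4 -> holds A (map_equation inj4 e)) /\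
     [/\ atoms_dense (@id A), atoms_dense (aop (a := A) (Transp (neq_map inj_rho n01)))
       & atoms_dense (aop (a := A) (Repl (neq_map inj_rho n01)))]).
Proof.
split=> m rho inj_rho.
  have mE e : List.In e schema -> models A (map_formula inj_rho e) by exact: m.
  split=> [e he|].
    rewrite -(map_equation_comp (@ord_inj 4) inj_rho).
    apply/models_closure; apply: (mE (closure _)); apply/In_cat; left.
    by apply/In_map; exists e.
  have mD e : List.In e [:: dense_formula (Var 1);
        dense_formula (Op (Transp n01) (Var 1));
        dense_formula (Op (Repl n01) (Var 1))] ->
      models A (map_formula inj_rho e) by move=> he; apply/mE/In_cat; right.
  split.
  - by apply/(@models_dense _ A (Var 1)) => //; apply: (mD (dense_formula (Var 1))); left.
  - apply/(@models_dense _ A (map_term inj_rho (Op (Transp n01) (Var 1)))) => //.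
    by apply: (mD (dense_formula (Op (Transp n01) (Var 1)))); right; left.
  - apply/(@models_dense _ A (map_term inj_rho (Op (Repl n01) (Var 1)))) => //.
    by apply: (mD (dense_formula (Op (Repl n01) (Var 1)))); right; right; left.
have [eqs [d1 d2 d3]] := m _ inj_rho.
move=> e /In_cat[/In_map[e0 [<- he0]]|].
  apply/(models_closure A (map_equation inj_rho (map_equation (@ord_inj 4) e0))).
  by rewrite (map_equation_comp _ _ (inj_comp inj_rho (@ord_inj 4))); apply: eqs.
case=> [<-|[<-|[<-|[]]]].
- exact/(@models_dense _ A (Var 1) id).
- exact/(@models_dense _ A (map_term inj_rho (Op (Transp n01) (Var 1)))
           (aop (map_gen inj_rho (Transp n01)))).
- exact/(@models_dense _ A (map_term inj_rho (Op (Repl n01) (Var 1)))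
           (aop (map_gen inj_rho (Repl n01)))).
Qed.

Lemma SA_equations4 (rho : 'I_4 -> alpha) (inj_rho : injective rho) e :
  SA pres A -> List.In e equations4 -> holds A (map_equation inj_rho e).
Proof.
move=> sA /equations4_Sigma he; apply: sA.
by exists 4; split=> //; exists rho, inj_rho, e.
Qed.

Lemma BA_equations4 (rho : 'I_4 -> alpha) (inj_rho : injective rho) :
  (forall e, List.In e (BA_axioms 'I_4) -> holds A (map_equation inj_rho e)) ->
  BA A.
Proof.
move=> h e; rewrite -[BA_axioms _]/(map (map_equation inj_rho) (BA_axioms 'I_4)).
by move=> /In_map[e0 [<- /h]].
Qed.

Lemma CRSA_schema : CRSA pres A ->
  forall (rho : nat -> alpha) (inj_rho : injective rho) e,
    List.In e schema -> models A (map_formula inj_rho e).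
Proof.
case=> sA [U [V [f [rf cf]]]]; apply/models_schema => rho inj_rho inj4.
have eqs e : List.In e equations4 -> holds A (map_equation inj4 e).
  exact: SA_equations4.
have hBA : BA A.
  by apply: (BA_equations4 (inj_rho := inj4)) => e he; apply: eqs; apply/In_cat; left.
have [sq _ _] := rf.
split=> //; split.
- by apply: (rep_dense hBA rf cf (F := id)).
- apply: (rep_dense hBA rf cf
            (F := fun q => q \o gen_fun (Transp (neq_map inj_rho n01)))).
    by move=> q; apply: sq.
  by move=> a q Vq qa; apply/rep_op.
- apply: (rep_dense hBA rf cf
            (F := fun q => q \o gen_fun (Repl (neq_map inj_rho n01)))).
    by move=> q; apply: sq.
  by move=> a q Vq qa; apply/rep_op.
Qed.

Section FromSchema.
Hypothesis m : forall (rho : nat -> alpha) (inj_rho : injective rho) e,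
  List.In e schema -> models A (map_formula inj_rho e).

Let eqs (rho : nat -> alpha) (inj_rho : injective rho) e :
  List.In e equations4 ->
  holds A (map_equation (inj_comp inj_rho (@ord_inj 4)) e).
Proof. by have [h _] := proj1 models_schema m rho inj_rho; apply: h. Qed.

Lemma schema_BA : BA A.
Proof.
have [rho inj_rho _] := extend_injection (L := [::]) inf_alpha isT.
apply: (BA_equations4 (inj_rho := inj_comp inj_rho (@ord_inj 4))) => e he.
by apply: eqs; apply/In_cat; left.
Qed.

Lemma gen_image01 g :
  exists (rho : nat -> alpha) (inj_rho : injective rho),
    g = map_gen inj_rho (Transp n01) \/ g = map_gen inj_rho (Repl n01).
Proof.
case: g => i j ij.
all: have uL : uniq [:: i; j] by rewrite /= inE ij.
all: have [rho inj_rho rhoE] := extend_injection inf_alpha uL.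
all: have := rhoE i 0 isT; have := rhoE i 1 isT; rewrite /= => ej ei; subst i j.
all: exists rho, inj_rho; rewrite /= (bool_irrelevance ij (neq_map inj_rho n01)).
all: by [left|right].
Qed.

Lemma schema_gen g :
  [/\ forall a b : A, aop g (ameet a b) = ameet (aop g a) (aop g b),
      forall a : A, aop g (acompl a) = acompl (aop g a)
    & atoms_dense (@aop _ A g)].
Proof.
have [rho [inj_rho gE]] := gen_image01 g.
have [_ [_ dT dR]] := (proj1 models_schema m) rho inj_rho.
have endo g4 : map_gen (inj_comp inj_rho (@ord_inj 4)) g4 = g ->
    (forall e, List.In e (endo_axioms g4) -> List.In e equations4) ->
    (forall a b : A, aop g (ameet a b) = ameet (aop g a) (aop g b)) /\
    (forall a : A, aop g (acompl a) = acompl (aop g a)).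
  move=> <- h; split=> [a b|a].
    exact: (eqs inj_rho (h _ (or_introl erefl)) (nth a [:: a; b])).
  exact: (eqs inj_rho (h _ (or_intror (or_introl erefl))) (fun=> a)).
case: gE => gE.
  have [|e he|h1 h2] := endo (Transp o01); last by split; rewrite // gE.
    by rewrite gE /=; congr Transp; apply: bool_irrelevance.
  by rewrite /equations4 !In_cat; tauto.
have [|e he|h1 h2] := endo (Repl o01); last by split; rewrite // gE.
  by rewrite gE /=; congr Repl; apply: bool_irrelevance.
by rewrite /equations4 !In_cat; tauto.
Qed.

(** For words over at most four indices, an injection covering these indices lifts both words to
    ['I_4]. There the presentation derives their equality, and each step of the derivation holds in
    [A]. *)
Lemma schema_word w1 w2 : word_fun w1 =1 word_fun w2 ->
  wact (@aop _ A) w1 =1 wact (@aop _ A) w2.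
Proof.
move: w1 w2; apply: local_relations_wact => L w1 w2 sL w1L w2L e12.
have [rho inj_rho rhoE] := extend_injection inf_alpha (undup_uniq L).
set inj4 := inj_comp inj_rho (@ord_inj 4).
have im x : x \in L -> exists i : 'I_4, x = (rho \o @nat_of_ord 4) i.
  rewrite -mem_undup => xL; have iL : index x (undup L) < size (undup L).
    by rewrite index_mem.
  have i4 : index x (undup L) < 4.
    by apply: leq_trans iL (leq_trans (size_undup L) sL).
  by exists (Ordinal i4); rewrite /= (rhoE x) // nth_index.
have [u1 e1] := lift_word inj4 w1L im; have [u2 e2] := lift_word inj4 w2L im.
have : word_cong (pres 4) u1 u2.
  apply/(proj2 (Hpres (isT : 2 <= 4))) => i; apply: (inj_comp inj_rho (@ord_inj 4)).
  by rewrite -!(word_fun_map inj4) -e1 -e2.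
(* In the case of a defining relation, the relation is used at the value of the right context, under
   the left one. *)
rewrite {}e1 {}e2; elim=> [u v r hr|//|v1 v2 _ ih x|v1 v2 v3 _ ih1 _ ih2 x].
- move=> x; rewrite /map_word !map_cat !wact_cat; congr (wact _ _ _).
  set y := wact _ _ x.
  have r4 : List.In (word_term r.1, word_term r.2) equations4.
    by rewrite /equations4 !In_cat In_map; do 3!right; exists r.
  by have := eqs inj_rho r4 (fun=> y); rewrite /= !map_word_term !eval_word_term.
- by rewrite ih.
- by rewrite ih1.
Qed.

(** A relation of the presentation for any [n] is true of the maps, and stays true after reindexing,
    so it follows from [schema_word]. *)
Lemma schema_SA : SA pres A.
Proof.
move=> e [n [n2 [rho [inj_rho [e0 [he0 ->]]]]]].
rewrite -[(_, _)]/(map_equation inj_rho e0).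
case: he0 => [e1 he1|g|g|r hr].
- apply: schema_BA.
  rewrite -[BA_axioms _]/(map (map_equation inj_rho) (BA_axioms 'I_n)).
  by apply/In_map; exists e1.
- by move=> v /=; case: (schema_gen (map_gen inj_rho g)).
- by move=> v /=; case: (schema_gen (map_gen inj_rho g)).
- move=> v; rewrite /= !map_word_term !eval_word_term.
  apply/schema_word/word_fun_map_eq; apply/(proj2 (Hpres n2)).
  (* A defining relation is a congruence step with empty contexts. *)
  by rewrite -[r.1]cats0 -[r.2]cats0; apply: (WCrel [::] [::] hr).
Qed.

Lemma schema_CRSA : CRSA pres A.
Proof.
split; first exact: schema_SA.
have [rho inj_rho _] := extend_injection (L := [::]) inf_alpha isT.
have [_ [d _ _]] := (proj1 models_schema m) rho inj_rho.
apply: (atomic_completely_representable (rho 0)) => //.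
- exact: schema_BA.
- by move=> g; case: (schema_gen g).
- by move=> g; case: (schema_gen g).
- exact: schema_word.
- by move=> g; case: (schema_gen g).
Qed.

End FromSchema.
End Models.
End Schema.

Lemma map_formula_sentence (I J : eqType) (rho : I -> J)
    (inj_rho : injective rho) phi :
  sentence phi -> sentence (map_formula inj_rho phi).
Proof.
have vt t : term_vars (map_term inj_rho t) = term_vars t.
  by elim: t => //= t1 -> t2 ->.
rewrite /sentence => <-; elim: phi => //= [t1 t2|p -> q ->//|n p -> //].
by rewrite !vt.
Qed.

Lemma finite_schema_elementary (alpha : eqType) (K : algebra alpha -> Prop) :
  finite_schema_axiomatizable K -> elementary K.
Proof.
case=> Gamma [sG KG].
exists [set phi | exists (rho : nat -> alpha) (inj_rho : injective rho) e,
    List.In e Gamma /\ phi = map_formula inj_rho e]%classic; split.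
  by move=> _ [rho [inj_rho [e [/sG he ->]]]]; apply: map_formula_sentence.
move=> A; rewrite KG; split=> h; first by move=> _ [rho [ir [e [he ->]]]]; apply: h.
by move=> rho ir e he; apply: h; exists rho, ir, e.
Qed.

Theorem theorem3p40 (pres : forall n : nat, seq (word 'I_n * word 'I_n))
    (Hpres : forall n : nat, 2 <= n -> presents (pres n))
    (alpha : eqType) (Halpha : infinite_set (@setT alpha)) :
  elementary (@CRSA pres alpha) /\
  finite_schema_axiomatizable (@CRSA pres alpha).
Proof.
suff h : finite_schema_axiomatizable (@CRSA pres alpha).
  by split=> //; apply: finite_schema_elementary.
exists (schema pres); split; first exact: schema_sentence.
by move=> A; split; [apply: CRSA_schema|apply: schema_CRSA].
Qed.
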